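(* Let $(U_k)_{k\ge1}$ and $(V_k)_{k\ge1}$ be independent sequences of i.i.d. positive random variables with cumulative distribution functions $F$ and $G$ respectively, and assume that $F$ and $G$ are not trivial. Put $X_k=\max\{U_1,\dots,U_k\}$, $Y_k=\max\{V_1,\dots,V_k\}$ and, for the initial capital $u$, $$\delta(u)=\mathbf{P}\bigl\{\max\{u,Y_k\}>X_k\ \text{ for all } k\in\mathbb{N}\bigr\},\qquad \mathbb{N}=\{1,2,\dots\}.$$ Then $$\delta(u)=\delta(u)\,G(u)\,F(u)+\int_u^\infty\delta(y)\,F(y)\,dG(y).$$ If the distribution functions $F$ and $G$ have densities $f$ and $g$, then $$\delta'(u)=\delta'(u)\,F(u)\,G(u)+\delta(u)\,G(u)\,f(u).$$
   Context: This concerns the non-ruin probability $\delta(u)$ in the infinite time horizon, with initial capital $u>0$, for the risk model based on the $\infty$-convolution (max-convolution) $\delta_x\diamond\delta_y=\delta_{\max\{x,y\}}$ of Dirac measures, where the cumulated claims are $X_k$ and the cumulated incomes started from the initial capital $u$ are $\max\{u,Y_k\}$. ''Not trivial'' is said in contrast to the case, treated separately, in which $G(x)=\mathbf{1}_{(a,\infty)}(x)$ for some $a>0$, i.e. $V_k=a$ for all $k$. *)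

(* Defs.v *)
From HB Require Import structures.
From mathcomp Require Import all_boot all_order all_algebra.
From mathcomp Require Import all_classical all_reals all_analysis.
Set Implicit Arguments.
Unset Strict Implicit.
Unset Printing Implicit Defensive.
Import Order.TTheory GRing.Theory Num.Theory.
Import numFieldNormedType.Exports.
Local Open Scope classical_set_scope.
Local Open Scope ring_scope.

Section Definitions.
Context {d : measure_display} {T : measurableType d} {R : realType}.
Variable P : probability T R.
Implicit Types (X : {RV P >-> R}) (U V : nat -> {RV P >-> R}).

(* Sequences are numbered from 0: U n stands for the claim U_{n+1}, and
   likewise for V. *)

(* Left-continuous cumulative distribution function x |-> P (X < x). A constant
   X = a then has the distribution function 1_(a, oo); with the right-continuous
   convention of [cdf] it would be 1_[a, oo). *)
Definition lcdf X (x : R) : R := fine (P [set w | X w < x]).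

(* The measure dG attached to the distribution function G = lcdf X is the law
   [distribution P X]. Since G is left-continuous, dG [a, b) = G b - G a, and
   an integral from u to oo with respect to dG is over [u, oo). *)
Lemma distribution_lcdf X (a b : R) : a <= b ->
  distribution P X `[a, b[%classic = (lcdf X b - lcdf X a)%:E.
Proof.
move=> ab.
have mlt c : measurable [set w | X w < c].
  rewrite -[X in measurable X]setTI.
  have -> : [set w | X w < c] = X @^-1` `]-oo, c[%classic.
    by apply/seteqP; split=> w /=; rewrite in_itv.
  exact: measurable_funPT.
have -> : distribution P X `[a, b[%classic =
    P ([set w | X w < b] `\` [set w | X w < a]).
  congr (P _); apply/seteqP; split=> w /=; rewrite in_itv /=.
    by move=> /andP[aw wb]; split=> //; apply/negP; rewrite -leNgt.
  by move=> [-> /negP]; rewrite -leNgt => ->.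
rewrite measureD//; last by rewrite ltey_eq fin_num_measure.
have -> : [set w | X w < b] `&` [set w | X w < a] = [set w | X w < a].
  by apply/setIidPr => w /= /lt_le_trans; apply.
by rewrite /lcdf EFinB !fineK// fin_num_measure.
Qed.

Definition mutually_independent U : Prop :=
  forall (s : seq nat) (B : nat -> set R), uniq s ->
    (forall n, measurable (B n)) ->
    P (\bigcap_(n in [set` s]) (U n @^-1` B n)) =
    (\prod_(n <- s) P (U n @^-1` B n))%E.

Definition identically_distributed U : Prop :=
  forall n (B : set R), measurable B -> P (U n @^-1` B) = P (U 0%N @^-1` B).

Definition iid U : Prop :=
  mutually_independent U /\ identically_distributed U.

(* sigma-algebra generated by the whole sequence *)
Definition sigma_seq U : set (set T) :=
  <<s \bigcup_n preimage_set_system setT (U n) measurable >>.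

Definition independent_seq U V : Prop :=
  forall A B, sigma_seq U A -> sigma_seq V B -> P (A `&` B) = (P A * P B)%E.

Definition positive_seq U : Prop := forall n, {ae P, forall w, 0 < U n w}.

(* [running_max U k w] is max {U 0 w, ..., U k w}. *)
Definition running_max U (k : nat) (w : T) : R :=
  \big[Num.max/U 0%N w]_(i < k.+1) U i w.

Definition non_ruin U V (u : R) : R :=
  fine (P [set w | forall k : nat,
    running_max U k w < Num.max u (running_max V k w)]).

End Definitions.

Definition trivial_df {R : realType} (F : R -> R) : Prop :=
  exists2 a, 0 < a & F = \1_(`]a, +oo[%classic).

Definition has_density {R : realType} (F f : R -> R) : Prop :=
  [/\ measurable_fun setT f, forall x, 0 <= f x &
      forall x, (F x)%:E =
        (\int[lebesgue_measure]_(y in `]-oo, x[%classic) (f y)%:E)%E].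

(* Main.v *)
(** Look backwards from the last step. Setting [W_0 = 0] and, with
    [Z = max (U_s, W_n)] where [W_n] is built from the steps after [s],
    [W_{n+1} = 0] if [Z < V_s] and [W_{n+1} = Z] otherwise, the first [n] steps
    are survived from the capital [y > 0] iff [W_n < y]. Since [U_s], [V_s] and
    the tail variable [W_n] are independent, Fubini's theorem applied to
    [{Z < max (u, V_s)}] gives the integral equation with [n + 1] steps on the
    left and [n] on the right, and [n] tends to infinity by dominated
    convergence.

    Subtracting the equation at two points [v <= w] bounds the increment of
    [delta * (1 - F * G)] by [- delta * F * (G w - G v)], with [delta * F] taken
    at [v] or at [w]. This makes [delta] continuous, then differentiable,
    wherever [F] and [G] are differentiable and [F * G < 1]. Where [F * G = 1],
    both functions are at their maximum, so [f = 0]; there [delta = 1], so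
    only the least such point can be a point of non-differentiability. *)

Require Import Defs.
From HB Require Import structures.
From mathcomp Require Import all_boot all_order all_algebra.
From mathcomp Require Import all_classical all_reals all_analysis.
From mathcomp Require Import measurable_realfun ring lra.
Import Order.TTheory GRing.Theory Num.Theory.
Import numFieldNormedType.Exports.
Local Open Scope ring_scope.
Local Open Scope classical_set_scope.

(** * Independence *)

(** Dynkin's argument: the events independent of [K] form a lambda-system, closed under increasing
    unions by continuity from below, so independence passes from an intersection-stable family to
    the sigma-algebra it generates. *)
Lemma independent_g_sigma_algebra d (T : measurableType d) (R : realType)
    (P : probability T R) (K : set T) (G : set (set T)) :
  measurable K -> setI_closed G -> G `<=` measurable ->
  (forall A, G A -> P (K `&` A) = (P K * P A)%E) ->
  forall A, <<s G >> A -> P (K `&` A) = (P K * P A)%E.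
Proof.
move=> mK GI mG KG.
pose H := [set A | measurable A /\ P (K `&` A) = (P K * P A)%E].
have HS : lambda_system setT H.
  split => //.
  - by split => //; rewrite setIT probability_setT mule1.
  - move=> A B BA [mA KA] [mB KB]; split; first exact: measurableD.
    rewrite setDE setIA -setDE measureD//=; [|exact: measurableI|];
      last by rewrite ltey_eq fin_num_measure//; exact: measurableI.
    rewrite [in RHS]measureD//; last by rewrite ltey_eq fin_num_measure.
    rewrite (setIidr BA) -setIA (setIidr BA).
    rewrite [LHS](_ : _ = P (K `&` A) - P (K `&` B))%E//.
    rewrite KA KB muleBr ?fin_num_measure//.
    by rewrite fin_num_adde_defr// fin_num_measure.
  - move=> F ndF HF; have mF n : measurable (F n) by have [] := HF n.
    split; first exact: bigcup_measurable.
    rewrite setI_bigcupr.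
    have c1 : (P \o (fun n => K `&` F n)) @ \oo --> P (\bigcup_n (K `&` F n)).
      apply: nondecreasing_cvg_mu.
      + by move=> n; exact: measurableI.
      + by apply: bigcup_measurable => n _; exact: measurableI.
      + by move=> m n mn; apply/subsetPset => w /= [Kw Fw]; split => //; move: w {Kw} Fw; apply/subsetPset; exact: ndF.
    have c2 : (P \o F) @ \oo --> P (\bigcup_n F n).
      by apply: nondecreasing_cvg_mu => //; exact: bigcup_measurable.
    have c3 : (fun n => P K * P (F n))%E @ \oo --> (P K * P (\bigcup_n F n))%E.
      by apply: cvgeZl => //; rewrite fin_num_measure.
    apply: cvg_unique c1 _ => //.
    rewrite (_ : _ \o _ = fun n => P K * P (F n))%E//.
    by apply/funext => n /=; have [] := HF n.
move=> A GA; suff [] : H A by [].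
by apply: (lambda_system_subset GI HS) GA => // B GB; split; [exact: mG|exact: KG].
Qed.

Lemma measurable_fun_pair_RV d (T : measurableType d) (R : realType)
    (P : probability T R) (X Y : {RV P >-> R}) :
  measurable_fun setT (fun w => (X w, Y w)).
Proof. by apply/measurable_fun_pairP; split; exact: measurable_funPT. Qed.

(** The open rays generate the Borel sets and are stable under intersection, so independence need
    only be tested on the events that distribution functions measure. *)
Lemma indep_rays_indep d (T : measurableType d) (R : realType)
    (P : probability T R) (X : {RV P >-> R}) (K : set T) :
  measurable K ->
  (forall x, P (K `&` [set w | X w < x]) = (P K * P [set w | (X w < x)%R])%E) ->
  forall B, measurable B -> P (K `&` X @^-1` B) = (P K * P (X @^-1` B))%E.
Proof.
move=> mK KX B mB.
apply: (@independent_g_sigma_algebra _ _ _ _ _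
  (preimage_set_system setT X (@RGenInftyO.G R))) => //.
- move=> _ _ [_ [x ->] <-] [_ [y ->] <-].
  exists `]-oo, Num.min x y[%classic; first by eexists.
  rewrite !setTI -preimage_setI; congr (_ @^-1` _); apply/seteqP.
  by split=> z /=; rewrite !in_itv/= lt_min => /andP.
- by move=> _ [_ [x ->] <-]; rewrite setTI; exact: measurable_funPTI.
- move=> _ [_ [x ->] <-]; rewrite setTI.
  have -> : X @^-1` `]-oo, x[ = [set w | X w < x].
    by apply/seteqP; split=> w /=; rewrite in_itv.
  exact: KX.
- rewrite g_sigma_preimageE; exists B; last by rewrite setTI.
  by rewrite -RGenInftyO.measurableE.
Qed.

Lemma measurable_RV_lt d (T : measurableType d) (R : realType)
    (P : probability T R) (X : {RV P >-> R}) (x : R) :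
  measurable [set w | X w < x].
Proof.
have -> : [set w | X w < x] = X @^-1` `]-oo, x[.
  by apply/seteqP; split=> w /=; rewrite in_itv.
exact: measurable_funPTI.
Qed.

(** Independence makes the joint law of [(V, X)] a product, and Fubini integrates the probabilities
    of the sections of [{u <= y, x < y}] over [y]. *)
Lemma prob_lt_indep d (T : measurableType d) (R : realType)
    (P : probability T R) (X V : {RV P >-> R}) (u : R) :
  (forall x D, measurable D ->
    P (V @^-1` D `&` [set w | X w < x]) =
    (P (V @^-1` D) * P [set w | (X w < x)%R])%E) ->
  P [set w | u <= V w /\ X w < V w] =
  (\int[distribution P V]_(y in `[u, +oo[%classic) P [set w | X w < y]%R)%E.
Proof.
move=> XV.
pose S := [set z : R * R | u <= z.1 /\ z.2 < z.1].
have mS : measurable S.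
  rewrite -[S]setTI.
  have -> : S = (fun z : R * R => (u <= z.1) && (z.2 < z.1)) @^-1` [set true].
    by apply/seteqP; split => z /=; [move=> [-> ->]|move=> /andP].
  suff: measurable_fun setT (fun z : R * R => (u <= z.1) && (z.2 < z.1)).
    by apply.
  apply: measurable_and.
    by apply: measurable_fun_ler.
  by apply: measurable_fun_ltr.
pose J : {mfun T >-> (R * R)%type} := HB.pack (fun w => (V w, X w))
  (isMeasurableFun.Build _ _ _ _ _ (@measurable_fun_pair_RV _ _ _ P V X)).
(* A product measure is determined by its values on rectangles. *)
have joint A : measurable A ->
    (distribution P V \x distribution P X)%E A = distribution P J A.
  apply: product_measure_unique => B C mB mC.
  change (P (V @^-1` B `&` X @^-1` C) = (P (V @^-1` B) * P (X @^-1` C))%E).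
  apply: indep_rays_indep => // [|x]; first exact: measurable_funPTI.
  exact: XV.
rewrite (_ : P _ = distribution P J S)// -joint// /product_measure1.
rewrite [RHS]integral_mkcond; apply: eq_integral => y _ /=.
rewrite patchE mem_setE in_itv/= andbT /distribution /pushforward.
(* The section at [y] is [{X < y}] if [u <= y] and empty otherwise, which restricts the integral to
   [[u, +oo[]. *)
case: ifPn => uy.
  congr (P _); apply/seteqP; split => w /=; first by move/set_mem => [].
  by move=> Xw; apply/mem_set; split.
transitivity (P set0); last by rewrite measure0.
congr (P _); apply/seteqP; split => w //= /set_mem [] /=.
by rewrite (negbTE uy).
Qed.

(** * Ruin thresholds *)

(* Survival of the first [n] steps, started at time [s] from the capital
   [y > 0], amounts to [ruin_threshold U V n s w < y]. *)
Fixpoint ruin_threshold {T : Type} {R : realType} (U V : nat -> T -> R)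
    (n s : nat) (w : T) : R :=
  if n is m.+1 then
    let z := Num.max (U s w) (ruin_threshold U V m s.+1 w) in
    if z < V s w then 0 else z
  else 0.

(** After step [s] the capital [y] has become [max (y, V_s)], from which the remaining steps must be
    survived; this drives the induction, with [y] generalized. *)
Lemma ruin_threshold_lt {T : Type} {R : realType} (U V : nat -> T -> R)
    (n s : nat) (w : T) (y : R) : 0 < y ->
  ruin_threshold U V n s w < y <->
  forall k, (k < n)%N ->
    U (s + k)%N w < y \/ exists2 j, (j <= k)%N & U (s + k)%N w < V (s + j)%N w.
Proof.
elim: n s y => [|n IH] s y y0 /=; first by [].
set z := Num.max _ _; set m := Num.max y (V s w).
have m0 : 0 < m by rewrite lt_max y0.
(* Since [0 < y], the default value 0 encodes survival from every admissible capital, so both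
   branches amount to [z < max (y, V_s)]. *)
have -> : ((if z < V s w then 0 else z) < y) = (z < m).
  by rewrite lt_max; case: (z < V s w); rewrite ?orbT ?y0 ?orbF.
rewrite gt_max; split.
  move=> /andP[Um /(IH _ _ m0) H] [_|k].
    rewrite addn0; move: Um; rewrite lt_max => /orP[|UV]; first by left.
    by right; exists 0%N; rewrite ?addn0.
  rewrite ltnS => /H; rewrite addSnnS => -[|[j jk Uj]].
    rewrite lt_max => /orP[|UV]; first by left.
    by right; exists 0%N; rewrite ?addn0.
  by right; exists j.+1 => //; rewrite -(addSnnS s j).
move=> H; apply/andP; split.
  have [|[j]] := H 0%N (ltn0Sn n); first by rewrite addn0 lt_max => ->.
  by rewrite leqn0 => /eqP ->; rewrite !addn0 lt_max => ->; rewrite orbT.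
apply/(IH _ _ m0) => k kn; rewrite addSnnS.
have [Uy|[[|j] jk Uj]] := H k.+1 kn; first by left; rewrite lt_max Uy.
  by left; move: Uj; rewrite addn0 lt_max => ->; rewrite orbT.
by right; exists j => //; rewrite addSnnS.
Qed.

(** Measurability is asked only from index [s] on, so that the lemma also applies to the
    sigma-algebra generated by the later steps. *)
Lemma measurable_ruin_threshold d (T : measurableType d) (R : realType)
    (U V : nat -> T -> R) (s : nat) :
  (forall n, (s <= n)%N -> measurable_fun setT (U n)) ->
  (forall n, (s <= n)%N -> measurable_fun setT (V n)) ->
  forall n, measurable_fun setT (ruin_threshold U V n s).
Proof.
move=> mU mV n; elim: n s mU mV => [|n IH] s mU mV /=; first exact: measurable_cst.
have mz : measurable_fun setT (U s \max ruin_threshold U V n s.+1).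
  apply: measurable_maxr; first exact: mU.
  by apply: IH => k sk; [apply: mU|apply: mV]; exact: ltnW.
apply: measurable_fun_ifT => //.
by apply: measurable_fun_ltr => //; exact: mV.
Qed.

(** * The non-ruin event in terms of thresholds *)

Section running_max.
Context {d : measure_display} {T : measurableType d} {R : realType}.
Variable P : probability T R.
Implicit Types (U V : nat -> {RV P >-> R}) (u : R) (w : T).

Lemma running_max_ltP U k w u :
  running_max U k w < u <-> forall i, (i <= k)%N -> U i w < u.
Proof.
split=> [/bigmax_ltP[_ H] i ik|H].
  by have := H (Ordinal (ik : i < k.+1)%N) isT.
by apply/bigmax_ltP; split=> [|i _]; [exact: H|apply: H; rewrite -ltnS].
Qed.

Lemma lt_running_max U k w u :
  u < running_max U k w <-> exists2 i, (i <= k)%N & u < U i w.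
Proof.
split=> [H|[i ik uU]]; last first.
  by apply: lt_le_trans uU _; exact: (le_bigmax _ _ (Ordinal (ik : i < k.+1)%N)).
apply/not_exists2P => H'; move: H; apply/negP; rewrite -leNgt.
apply/bigmax_leP; split=> [|i _]; rewrite leNgt; apply/negP => uU.
  by have [] := H' 0%N.
by have [] := H' i; rewrite // -ltnS.
Qed.

(** The capital [max (u, Y_k)] grows with [k], so comparing it with the running maximum of the
    claims at all times is the same as comparing it with the latest claim at all times. *)
Lemma non_ruin_eventE U V u : 0 < u ->
  [set w | forall k, running_max U k w < Num.max u (running_max V k w)] =
  \bigcap_n [set w | ruin_threshold (fun i => U i) (fun i => V i) n 0 w < u].
Proof.
move=> u0; apply/seteqP; split=> w /=.
  move=> H n _ /=; apply/ruin_threshold_lt => // k kn; rewrite add0n.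
  have {H} := H k => /running_max_ltP/(_ k (leqnn k)).
  by rewrite lt_max => /orP[|/lt_running_max]; [left|right].
move=> H k; apply/running_max_ltP => i ik; rewrite lt_max.
have /ruin_threshold_lt := H i.+1 I => /(_ u0 i (ltnSn i)).
rewrite !add0n => -[->//|[j ji UV]]; apply/orP; right.
by apply/lt_running_max; exists j => //; exact: leq_trans ji ik.
Qed.

End running_max.

(** * Independence of one step from the later steps *)

Section independence.
Context {d : measure_display} {T : measurableType d} {R : realType}.
Context {P : probability T R} {U V : nat -> {RV P >-> R}}.
Hypotheses (indepU : mutually_independent U) (indepV : mutually_independent V).
Hypothesis indepUV : independent_seq U V.

Definition cylinder (l : seq nat) (B C : nat -> set R) : set T :=
  (\bigcap_(n in [set` l]) (U n @^-1` B n)) `&`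
  (\bigcap_(n in [set` l]) (V n @^-1` C n)).

Lemma sigma_seq_bigcap (W : nat -> {RV P >-> R}) (l : seq nat)
    (B : nat -> set R) : (forall n, measurable (B n)) ->
  sigma_seq W (\bigcap_(n in [set` l]) (W n @^-1` B n)).
Proof.
move=> mB; set G := \bigcup_n preimage_set_system setT (W n) measurable.
suff: measurable (\bigcap_(n in [set` l]) (W n @^-1` B n)
    : set (g_sigma_algebraType G)) by [].
apply: fin_bigcap_measurable => // n _.
by apply: sub_sigma_algebra; exists n => //; exists (B n); rewrite ?setTI.
Qed.

Lemma cylinder_prob (l : seq nat) (B C : nat -> set R) : uniq l ->
  (forall n, measurable (B n)) -> (forall n, measurable (C n)) ->
  P (cylinder l B C) =
  ((\prod_(n <- l) P (U n @^-1` B n)) * (\prod_(n <- l) P (V n @^-1` C n)))%E.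
Proof.
move=> ul mB mC; rewrite indepUV; [|exact: sigma_seq_bigcap..].
by rewrite indepU// indepV.
Qed.

Lemma measurable_cylinder (l : seq nat) (B C : nat -> set R) :
  (forall n, measurable (B n)) -> (forall n, measurable (C n)) ->
  measurable (cylinder l B C).
Proof.
move=> mB mC; apply: measurableI; apply: fin_bigcap_measurable => // n _.
  exact: measurable_funPTI.
exact: measurable_funPTI.
Qed.

(** A pi-system for the steps after [s]: each member constrains the finite block of indices
    [s + 1, ..., s + m]. *)
Definition tail_cylinder (s : nat) : set (set T) :=
  [set A | exists m B C, [/\ forall n, measurable (B n),
    forall n, measurable (C n) & A = cylinder (iota s.+1 m) B C]].

Lemma tail_cylinderI s : setI_closed (tail_cylinder s).
Proof.
move=> _ _ [m1 [B1 [C1 [mB1 mC1 ->]]]] [m2 [B2 [C2 [mB2 mC2 ->]]]].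
(* Both blocks are padded with [setT] up to the longer length and then intersected
   coordinatewise. *)
pose cut m (B : nat -> set R) n := if (n < s.+1 + m)%N then B n else setT.
have cutE m m' B : (m <= m')%N -> forall W : nat -> {RV P >-> R},
    \bigcap_(n in [set` iota s.+1 m]) (W n @^-1` B n) =
    \bigcap_(n in [set` iota s.+1 m']) (W n @^-1` cut m B n).
  move=> mm' W; apply/seteqP; split => w /= H n /=; rewrite mem_iota => /andP[sn nm].
    rewrite /cut; case: ifPn => // nm'; apply: H => /=.
    by rewrite mem_iota sn.
  have := H n; rewrite /cut/= mem_iota sn nm; apply => /=.
  by apply: leq_trans nm _; rewrite leq_add2l.
have mcut m B : (forall n, measurable (B n)) -> forall n, measurable (cut m B n).
  by move=> mB n; rewrite /cut; case: ifP.
exists (maxn m1 m2), (fun n => cut m1 B1 n `&` cut m2 B2 n),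
  (fun n => cut m1 C1 n `&` cut m2 C2 n); split.
- by move=> n; apply: measurableI; exact: mcut.
- by move=> n; apply: measurableI; exact: mcut.
rewrite /cylinder !(cutE _ _ _ (leq_maxl m1 m2)) !(cutE _ _ _ (leq_maxr m1 m2)).
by rewrite setIACA -!bigcapI.
Qed.

(** Prefixing step [s] to a cylinder of later steps gives a cylinder again, whose probability
    factors; Dynkin's argument then reaches the whole tail sigma-algebra. *)
Lemma prob_cylinder_tail (s : nat) (B C : set R) (A : set T) :
  measurable B -> measurable C -> <<s tail_cylinder s >> A ->
  P (U s @^-1` B `&` V s @^-1` C `&` A) =
  (P (U s @^-1` B) * P (V s @^-1` C) * P A)%E.
Proof.
move=> mB mC.
have PK : P (U s @^-1` B `&` V s @^-1` C) =
    (P (U s @^-1` B) * P (V s @^-1` C))%E.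
  have := @cylinder_prob [:: s] (fun=> B) (fun=> C) isT (fun=> mB) (fun=> mC).
  rewrite !big_seq1 => <-; congr (P _).
  by rewrite /cylinder set_cons1 !bigcap_set1.
rewrite -PK; apply: independent_g_sigma_algebra.
- by apply: measurableI; exact: measurable_funPTI.
- exact: tail_cylinderI.
- by move=> _ [m [B' [C' [mB' mC' ->]]]]; exact: measurable_cylinder.
move=> _ [m [B' [C' [mB' mC' ->]]]].
(* The constraint of step [s] is inserted in front of those of the later indices. *)
pose upd (B : set R) (B' : nat -> set R) n := if n == s then B else B' n.
have mupd D D' : measurable D -> (forall n, measurable (D' n)) ->
    forall n, measurable (upd D D' n).
  by move=> mD mD' n; rewrite /upd; case: ifP.
have sE n : n \in iota s.+1 m -> (n == s) = false.
  by rewrite mem_iota => /andP[sn _]; rewrite gtn_eqF.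
have updE D D' (W : nat -> {RV P >-> R}) :
    \bigcap_(n in [set` iota s m.+1]) (W n @^-1` upd D D' n) =
    W s @^-1` D `&` \bigcap_(n in [set` iota s.+1 m]) (W n @^-1` D' n).
  apply/seteqP; split => w /=.
    move=> H; split=> [|n /= nl].
      by have := H s; rewrite /upd eqxx; apply => /=; rewrite mem_head.
    have := H n; rewrite /upd sE//; apply => /=.
    by rewrite in_cons nl orbT.
  move=> [Hs H] n /=; rewrite in_cons => /orP[/eqP ->|nl].
    by rewrite /upd eqxx.
  by rewrite /upd sE//; exact: H.
have -> : U s @^-1` B `&` V s @^-1` C `&` cylinder (iota s.+1 m) B' C' =
    cylinder (iota s m.+1) (upd B B') (upd C C').
  by rewrite /cylinder !updE setIACA.
rewrite PK !cylinder_prob ?iota_uniq//; [|exact: mupd..].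
rewrite /= !big_cons /upd !eqxx muleACA; congr (_ * _)%E; congr (_ * _)%E.
  by apply: eq_big_seq => n nl; rewrite sE.
by apply: eq_big_seq => n nl; rewrite sE.
Qed.

Let thr := ruin_threshold (fun i => U i) (fun i => V i).

(** The threshold started at [s + 1] is built from later claims and incomes only, so it is
    measurable for the sigma-algebra they generate. *)
Lemma tail_ruin_threshold n s x :
  <<s tail_cylinder s >> [set w | thr n s.+1 w < x].
Proof.
have gen (W : nat -> {RV P >-> R}) : (forall k (B : set R), (s < k)%N ->
    measurable B -> tail_cylinder s (W k @^-1` B)) ->
    forall k, (s < k)%N ->
    measurable_fun setT (W k : g_sigma_algebraType (tail_cylinder s) -> R).
  move=> H k sk _ B mB; rewrite setTI; apply: sub_sigma_algebra; exact: H.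
(* A condition on the single index [k] is a cylinder on [s + 1, ..., k], trivial except at its last
   index. *)
have one k (B : set R) (W : nat -> {RV P >-> R}) : (s < k)%N ->
    W k @^-1` B = \bigcap_(n in [set` iota s.+1 (k - s)])
      (W n @^-1` (if n == k then B else setT)).
  move=> sk; apply/seteqP; split => w /=.
    by move=> Bw i _; case: eqP => // ->.
  move=> /(_ k) /=; rewrite eqxx; apply.
  by rewrite mem_iota sk/= addSn subnKC// ltnW.
have mone k (B : set R) : measurable B ->
    forall n : nat, measurable (if n == k then B else setT).
  by move=> mB m; case: ifP.
have bigcapT (W : nat -> {RV P >-> R}) (l : seq nat) :
    \bigcap_(n in [set` l]) (W n @^-1` setT) = setT.
  by apply/seteqP; split => // w _ n _.
suff: measurable_fun setT
    (thr n s.+1 : g_sigma_algebraType (tail_cylinder s) -> R).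
  move=> /(_ measurableT `]-oo, x[%classic (measurable_itv _)).
  rewrite setTI => mx.
  have -> // : [set w | thr n s.+1 w < x] = thr n s.+1 @^-1` `]-oo, x[.
  by apply/seteqP; split => w /=; rewrite in_itv.
apply: measurable_ruin_threshold => k sk; apply: gen => // {sk}k B sk mB.
  exists (k - s)%N, (fun n => if n == k then B else setT), (fun=> setT).
  by split => //; [exact: mone|rewrite /cylinder bigcapT setIT -one].
exists (k - s)%N, (fun=> setT), (fun n => if n == k then B else setT).
by split => //; [exact: mone|rewrite /cylinder bigcapT setTI -one].
Qed.

End independence.

(** * The integral equation *)

Section lcdf_theory.
Context {d : measure_display} {T : measurableType d} {R : realType}.
Context {P : probability T R}.
Implicit Type X : {RV P >-> R}.

Lemma lcdfE X x : (lcdf X x)%:E = P [set w | X w < x].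
Proof. by rewrite /lcdf fineK// fin_num_measure//; exact: measurable_RV_lt. Qed.

Lemma lcdf_ge0 X x : 0 <= lcdf X x.
Proof. by rewrite -lee_fin lcdfE. Qed.

Lemma lcdf_le1 X x : lcdf X x <= 1.
Proof. by rewrite -lee_fin lcdfE probability_le1//; exact: measurable_RV_lt. Qed.

Lemma lcdf_nd X : nondecreasing_fun (lcdf X).
Proof.
move=> x y xy; rewrite -lee_fin !lcdfE le_measure ?inE//; [exact: measurable_RV_lt..|].
by move=> w /= /lt_le_trans; apply.
Qed.

End lcdf_theory.

Section integral_equation.
Context {d : measure_display} {T : measurableType d} {R : realType}.
Context {P : probability T R} {U V : nat -> {RV P >-> R}}.
Hypotheses (iidU : iid U) (iidV : iid V) (indepUV : independent_seq U V).

Let measurable_threshold n s : measurable_fun setT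
  (ruin_threshold (fun i => U i) (fun i => V i) n s).
Proof. by apply: measurable_ruin_threshold => k _; exact: measurable_funPT. Qed.

Definition threshold n s : {RV P >-> R} :=
  HB.pack (ruin_threshold (fun i => U i) (fun i => V i) n s)
    (isMeasurableFun.Build _ _ _ _ _ (measurable_threshold n s)).

Let measurable_first_claim n s :
  measurable_fun setT (U s \max threshold n s.+1).
Proof. by apply: measurable_maxr; exact: measurable_funPT. Qed.

(** The variable [z] in the recursion of [ruin_threshold], before the income [V_s] is taken into
    account. *)
Definition threshold_claim n s : {RV P >-> R} :=
  HB.pack (U s \max threshold n s.+1)
    (isMeasurableFun.Build _ _ _ _ _ (measurable_first_claim n s)).

Lemma iid_lcdf (W : nat -> {RV P >-> R}) s : iid W -> lcdf (W s) = lcdf (W 0%N).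
Proof.
move=> [_ idW]; apply/funext => x; apply: EFin_inj; rewrite !lcdfE.
have lt_preimage (X : {RV P >-> R}) :
    [set w | X w < x] = X @^-1` `]-oo, x[%classic.
  by apply/seteqP; split => w /=; rewrite in_itv.
by rewrite !lt_preimage; exact: idW.
Qed.

Lemma threshold_claim_indep n s x (D : set R) : measurable D ->
  P (V s @^-1` D `&` [set w | threshold_claim n s w < x]) =
  (P (V s @^-1` D) * (lcdf (U s) x * lcdf (threshold n s.+1) x)%:E)%E.
Proof.
move=> mD; have [[indU _] [indV _]] := (iidU, iidV).
have -> : V s @^-1` D `&` [set w | threshold_claim n s w < x] =
    (U s @^-1` `]-oo, x[ `&` V s @^-1` D) `&` [set w | threshold n s.+1 w < x].
  apply/seteqP; split => w /=; rewrite in_itv/= gt_max.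
    by move=> [? /andP[]].
  by move=> [[-> ?] ->].
rewrite prob_cylinder_tail//; last exact: tail_ruin_threshold.
rewrite -lcdfE (_ : U s @^-1` _ = [set w | U s w < x]); last first.
  by apply/seteqP; split => w /=; rewrite in_itv.
by rewrite -!lcdfE EFinM [in LHS](muleC (lcdf _ _)%:E) muleA.
Qed.

Lemma lcdf_threshold_claim n s x :
  lcdf (threshold_claim n s) x = lcdf (U s) x * lcdf (threshold n s.+1) x.
Proof.
apply: EFin_inj; rewrite lcdfE.
have := @threshold_claim_indep n s x setT measurableT.
by rewrite preimage_setT setTI probability_setT mul1e.
Qed.

(** Survival means [Z < max (u, V_s)]. On [V_s < u] independence gives a product; on [u <= V_s]
    Fubini gives the integral. *)
Lemma lcdf_threshold_rec n s u : 0 < u ->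
  (lcdf (threshold n.+1 s) u)%:E =
  ((lcdf (threshold n s.+1) u * lcdf (V 0%N) u * lcdf (U 0%N) u)%:E +
   \int[distribution P (V 0%N)]_(y in `[u, +oo[%classic)
     (lcdf (threshold n s.+1) y * lcdf (U 0%N) y)%:E)%E.
Proof.
move=> u0; pose Z := threshold_claim n s.
rewrite lcdfE.
have -> : [set w | threshold n.+1 s w < u] =
    (V s @^-1` `]-oo, u[ `&` [set w | Z w < u]) `|`
    [set w | u <= V s w /\ Z w < V s w].
  apply/seteqP; split => w /=; rewrite in_itv/= -/(Z w).
    case: ifPn => ZV => [_|Zu].
      by have [uV|Vu] := leP u (V s w); [right|left; split => //; exact: lt_trans Vu].
    left; split => //; apply: le_lt_trans Zu.
    by rewrite leNgt.
  move=> [[Vu Zu]|[uV ->//]].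
  by case: ifP.
have mZ : measurable [set w | u <= V s w /\ Z w < V s w].
  have -> : [set w | u <= V s w /\ Z w < V s w] =
      (fun w => (u <= V s w) && (Z w < V s w)) @^-1` [set true].
    by apply/seteqP; split => w /=; [move=> [-> ->]|move=> /andP].
  rewrite -[X in measurable X]setTI.
  suff : measurable_fun setT (fun w => (u <= V s w) && (Z w < V s w)) by apply.
  by apply: measurable_and; [apply: measurable_fun_ler|apply: measurable_fun_ltr].
rewrite measureU//; last 2 first.
- apply: measurableI; [exact: measurable_funPTI|exact: measurable_RV_lt].
- apply/seteqP; split => w //= [[]]; rewrite in_itv/= => Vu _ [].
  by rewrite leNgt Vu.
congr (_ + _)%E.
  transitivity (P (V s @^-1` `]-oo, u[ `&` [set w | Z w < u])); first by [].
  rewrite threshold_claim_indep// (_ : _ @^-1` _ = [set w | V s w < u]).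
    rewrite -lcdfE (iid_lcdf _ s iidU) (iid_lcdf _ s iidV) -EFinM; congr _%:E.
    by rewrite mulrCA mulrC (mulrC (lcdf (V 0%N) u)).
  by apply/seteqP; split => w /=; rewrite in_itv.
transitivity (P [set w | u <= V s w /\ Z w < V s w]); first by [].
rewrite prob_lt_indep.
  under eq_integral do rewrite -lcdfE lcdf_threshold_claim (iid_lcdf _ s iidU) mulrC.
  apply: eq_measure_integral => D mD _.
  by case: iidV => _; apply.
by move=> x D mD; rewrite threshold_claim_indep// -lcdfE lcdf_threshold_claim.
Qed.

(** The recursion determines the distribution function on the positive axis without reference to
    [s], so no invariance of the joint law under shifts has to be established. *)
Lemma lcdf_threshold_shift n s u : 0 < u ->
  lcdf (threshold n s) u = lcdf (threshold n 0) u.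
Proof.
elim: n s u => [|n IH] s u u0.
  by rewrite /lcdf.
apply: EFin_inj; rewrite !lcdf_threshold_rec// !(IH _.+1)//; congr (_ + _)%E.
apply: eq_integral => y; rewrite inE/= in_itv/= andbT => uy.
by rewrite !(IH _.+1)// (lt_le_trans u0).
Qed.

Lemma measurable_non_ruin u : 0 < u ->
  measurable [set w | forall k, running_max U k w < Num.max u (running_max V k w)].
Proof.
move=> u0; rewrite non_ruin_eventE//.
by apply: bigcapT_measurable => n; exact: (measurable_RV_lt _ _ _ _ (threshold n 0)).
Qed.

Lemma non_ruinE u : 0 < u -> (non_ruin U V u)%:E =
  P [set w | forall k, running_max U k w < Num.max u (running_max V k w)].
Proof.
by move=> u0; rewrite /non_ruin fineK// fin_num_measure//; exact: measurable_non_ruin.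
Qed.

Lemma non_ruin_ge0 u : 0 < u -> 0 <= non_ruin U V u.
Proof. by move=> u0; rewrite -lee_fin non_ruinE. Qed.

Lemma non_ruin_le1 u : 0 < u -> non_ruin U V u <= 1.
Proof.
by move=> u0; rewrite -lee_fin non_ruinE// probability_le1//; exact: measurable_non_ruin.
Qed.

Lemma non_ruin_nd u v : 0 < u -> u <= v -> non_ruin U V u <= non_ruin U V v.
Proof.
move=> u0 uv; have v0 := lt_le_trans u0 uv.
rewrite -lee_fin !non_ruinE//; apply: le_measure; rewrite ?inE.
- exact: measurable_non_ruin.
- exact: measurable_non_ruin.
move=> w /= H k; apply: lt_le_trans (H k) _.
by rewrite ge_max !le_max uv lexx orbT.
Qed.

(** Surviving more steps is a smaller event; continuity from above gives the limit. *)
Lemma cvg_lcdf_threshold u : 0 < u ->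
  (lcdf (threshold n 0) u)%:E @[n --> \oo] --> (non_ruin U V u)%:E.
Proof.
move=> u0; rewrite non_ruinE// non_ruin_eventE//.
rewrite (_ : (fun _ => _) =
    P \o (fun n => [set w | threshold n 0 w < u])); last first.
  by apply/funext => n /=; rewrite lcdfE.
apply: nonincreasing_cvg_mu.
- by rewrite ltey_eq fin_num_measure//; exact: measurable_RV_lt.
- by move=> n; exact: measurable_RV_lt.
- by apply: bigcapT_measurable => n; exact: (measurable_RV_lt _ _ _ _ (threshold n 0)).
move=> m n mn; apply/subsetPset => w /= /(ruin_threshold_lt _ _ _ _ _ _ u0) H.
by apply/ruin_threshold_lt => // k km; apply: H; exact: leq_trans mn.
Qed.

Lemma cvg_lcdf_threshold_lcdf y : 0 < y ->
  (lcdf (threshold n 0) y * lcdf (U 0%N) y)%:E @[n --> \oo] -->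
  (non_ruin U V y * lcdf (U 0%N) y)%:E.
Proof.
move=> y0; under eq_fun do rewrite EFinM.
by rewrite EFinM; apply: cvgeZr => //; exact: cvg_lcdf_threshold.
Qed.

Lemma measurable_threshold_lcdf n (D : set R) : measurable D ->
  measurable_fun D (fun y => (lcdf (threshold n 0) y * lcdf (U 0%N) y)%:E).
Proof.
by move=> mD; apply/measurable_EFinP/measurable_funM;
  (apply: nondecreasing_measurable => //; exact: lcdf_nd).
Qed.

Lemma measurable_non_ruin_lcdf (D : set R) : measurable D ->
  (forall y, D y -> 0 < y) ->
  measurable_fun D (fun y => (non_ruin U V y * lcdf (U 0%N) y)%:E).
Proof.
move=> mD D0; apply: (emeasurable_fun_cvg
  (fun n y => (lcdf (threshold n 0) y * lcdf (U 0%N) y)%:E)) => [n|y /D0 y0].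
  exact: measurable_threshold_lcdf.
exact: cvg_lcdf_threshold_lcdf.
Qed.

Theorem non_ruin_integral_equation u : 0 < u ->
  (non_ruin U V u)%:E =
  ((non_ruin U V u * lcdf (V 0%N) u * lcdf (U 0%N) u)%:E +
   \int[distribution P (V 0%N)]_(y in `[u, +oo[%classic)
     (non_ruin U V y * lcdf (U 0%N) y)%:E)%E.
Proof.
move=> u0.
have gt0 y : `[u, +oo[%classic y -> 0 < y.
  by rewrite /= in_itv/= andbT; exact: lt_le_trans.
pose f_ n y := (lcdf (threshold n 0) y * lcdf (U 0%N) y)%:E.
pose mu := distribution P (V 0%N).
have [_ _ cvgI] : [/\ mu.-integrable `[u, +oo[
      (fun y => (non_ruin U V y * lcdf (U 0%N) y)%:E),
    [sequence \int[mu]_(y in `[u, +oo[)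
      `|f_ n y - (non_ruin U V y * lcdf (U 0%N) y)%:E|]_n%E @ \oo --> 0%E &
    [sequence \int[mu]_(y in `[u, +oo[) f_ n y]_n%E @ \oo -->
      (\int[mu]_(y in `[u, +oo[) (non_ruin U V y * lcdf (U 0%N) y)%:E)%E].
  (* The integrands are products of probabilities, hence at most 1, and the law of [V_0] is
     finite. *)
  apply: (@dominated_convergence _ _ _ _ _ _ _ _ (cst 1%E)) => //.
  - by move=> n; exact: measurable_threshold_lcdf.
  - exact: measurable_non_ruin_lcdf.
  - by apply: aeW => y uy; exact: cvg_lcdf_threshold_lcdf (gt0 y uy).
  - exact: finite_measure_integrable_cst.
  apply: aeW => y n _ /=; rewrite ger0_norm ?mulr_ge0 ?lcdf_ge0// lee_fin.
  by rewrite mulr_ile1 ?lcdf_ge0 ?lcdf_le1.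
have cvgL : (lcdf (threshold n.+1 0) u)%:E @[n --> \oo] --> (non_ruin U V u)%:E.
  by rewrite (cvg_shiftS (fun n => (lcdf (threshold n 0) u)%:E));
    exact: cvg_lcdf_threshold.
apply: cvg_unique cvgL _ => //.
rewrite (_ : (fun _ => _) = fun n =>
  ((lcdf (threshold n 0) u * lcdf (U 0%N) u)%:E * (lcdf (V 0%N) u)%:E +
   \int[mu]_(y in `[u, +oo[) f_ n y)%E).
  apply: cvgeD => //.
    rewrite mulrAC EFinM; apply: cvgeZr => //; exact: cvg_lcdf_threshold_lcdf.
apply/funext => n; rewrite lcdf_threshold_rec// lcdf_threshold_shift//.
rewrite -EFinM mulrAC; congr (_ + _)%E.
apply: eq_integral => y; rewrite inE => /gt0 y0.
by rewrite lcdf_threshold_shift.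
Qed.

End integral_equation.

(** * The differential equation *)

Section renewal_inequality.
Context {d : measure_display} {T : measurableType d} {R : realType}.
Context {P : probability T R} {U V : nat -> {RV P >-> R}}.
Hypotheses (iidU : iid U) (iidV : iid V) (indepUV : independent_seq U V).

Let F := lcdf (U 0%N).
Let G := lcdf (V 0%N).
Let delta := non_ruin U V.

(** The middle term is the integral of [delta * F] over [[v, w[], a nondecreasing integrand on a set
    of mass [G w - G v]. *)
Lemma non_ruin_increment v w : 0 < v -> v <= w ->
  delta v * F v * (G w - G v) <=
    delta v * (1 - G v * F v) - delta w * (1 - G w * F w) <=
    delta w * F w * (G w - G v).
Proof.
move=> v0 vw; have w0 := lt_le_trans v0 vw.
pose mu := distribution P (V 0%N).
pose h y := (delta y * F y)%:E.
have h0 y : 0 < y -> (0 <= h y)%E.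
  by move=> y0; rewrite lee_fin mulr_ge0 ?lcdf_ge0//; exact: non_ruin_ge0.
have nd x y : 0 < x -> x <= y -> delta x * F x <= delta y * F y.
  move=> x0 xy; apply: ler_pM; rewrite ?lcdf_ge0//; last exact: lcdf_nd.
    exact: non_ruin_ge0.
  exact: non_ruin_nd.
have mh (D : set R) : measurable D -> (forall y, D y -> 0 < y) ->
    measurable_fun D h by move=> mD; exact: measurable_non_ruin_lcdf.
have pos_vw y : `[v, w[%classic y -> 0 < y.
  by rewrite /= in_itv/= => /andP[vy _]; exact: lt_le_trans vy.
have pos_w y : `[w, +oo[%classic y -> 0 < y.
  by rewrite /= in_itv/= andbT; exact: lt_le_trans.
have pos_v y : `[v, +oo[%classic y -> 0 < y.
  by rewrite /= in_itv/= andbT; exact: lt_le_trans.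
have vE : `[v, +oo[%classic = `[v, w[%classic `|` `[w, +oo[%classic.
  by rewrite -itv_bndbnd_setU// bnd_simp.
have split_int : (\int[mu]_(y in `[v, +oo[%classic) h y =
    \int[mu]_(y in `[v, w[%classic) h y + \int[mu]_(y in `[w, +oo[%classic) h y)%E.
  rewrite vE ge0_integral_setU//.
  - by rewrite -vE; apply: mh.
  - by rewrite -vE => y /pos_v; exact: h0.
  apply/disj_setPRL => y /= ; rewrite !in_itv/= andbT => wy.
  by move/andP => [_]; rewrite ltNge wy.
have muE : mu `[v, w[%classic = (G w - G v)%:E by exact: distribution_lcdf.
have int_cst c : (\int[mu]_(y in `[v, w[%classic) c%:E = (c * (G w - G v))%:E)%E.
  by rewrite -[LHS]/(integral _ _ (cst c%:E)) integral_cst// [X in (_ * X)%E]muE.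
have lo : ((delta v * F v * (G w - G v))%:E <=
    \int[mu]_(y in `[v, w[%classic) h y)%E.
  rewrite -int_cst; apply: ge0_le_integral => //.
  - by move=> y _; exact: h0.
  - exact: mh.
  - by move=> y; rewrite /= in_itv/= => /andP[vy _]; rewrite lee_fin; exact: nd.
have up : (\int[mu]_(y in `[v, w[%classic) h y <=
    (delta w * F w * (G w - G v))%:E)%E.
  rewrite -int_cst; apply: ge0_le_integral => //.
  - by move=> y /pos_vw; exact: h0.
  - exact: mh.
  - move=> y yvw; rewrite lee_fin; apply: nd; first exact: pos_vw.
    by move: yvw; rewrite /= in_itv/= => /andP[_ /ltW].
have ev := non_ruin_integral_equation iidU iidV indepUV v v0.
have ew := non_ruin_integral_equation iidU iidV indepUV w w0.
(* Solves the integral equation at [x] for its integral term, which is thereby finite and can be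
   cancelled. *)
have phiE x (i : \bar R) : (delta x)%:E = ((delta x * G x * F x)%:E + i)%E ->
    i = (delta x * (1 - G x * F x))%:E.
  move=> e; rewrite mulrBr mulr1 mulrA EFinB e addeAC -EFinN -EFinD subrr.
  by rewrite add0e.
have {}ew := phiE _ _ ew; have {}ev := phiE _ _ ev.
move: ev; rewrite split_int ew => ev.
have {}ev : (\int[mu]_(y in `[v, w[%classic) h y =
    (delta v * (1 - G v * F v) - delta w * (1 - G w * F w))%:E)%E.
  by rewrite EFinB -ev addeK.
by move: lo up; rewrite ev !lee_fin => -> ->.
Qed.

End renewal_inequality.

(** A form of Carathéodory's criterion in which the slope [h] need only converge to [a]; its value
    at [x] is replaced by [a]. *)
Lemma is_derive_near_slope {R : realType} (f h : R -> R) (x a : R) :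
  (\forall z \near x, f z - f x = h z * (z - x)) ->
  h @ x --> a -> is_derive x 1 f a.
Proof.
move=> fh ha; apply/is_derive1_caratheodory.
exists (fun z => if z == x then a else (f z - f x) / (z - x)); split.
- move=> z; case: eqVneq => [->|zx]; first by rewrite !subrr mulr0.
  by rewrite divfK// subr_eq0.
- apply/continuous_withinNx; rewrite eqxx.
  have : h z @[z --> x^'] --> a by exact: cvg_within_filter.
  apply: cvg_trans; apply: near_eq_cvg; near=> z.
  rewrite ifN; last by near: z; exact: nbhs_dnbhs_neq.
  rewrite (_ : f z - f x = h z * (z - x)); last by near: z; exact: nbhs_dnbhs.
  rewrite mulfK// subr_eq0; near: z; exact: nbhs_dnbhs_neq.
- by rewrite eqxx.
Unshelve. all: by end_near. Qed.

Lemma cvg_near_normB {R : realType} {T : Type} {F : set_system T} {FF : Filter F}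
    (b a : T -> R) (l : R) :
  (\forall z \near F, `|a z - l| <= b z) -> b @ F --> 0 -> a @ F --> l.
Proof.
move=> ab b0; apply: (@squeeze_cvgr _ _ _ _ (fun z => l - b z) (fun z => l + b z)).
- by near=> z; rewrite -ler_distl; near: z.
- by rewrite -[X in _ --> X]subr0; apply: cvgB => //; exact: cvg_cst.
- by rewrite -[X in _ --> X]addr0; apply: cvgD => //; exact: cvg_cst.
Unshelve. all: by end_near. Qed.

Lemma cvg_normB0 {R : realType} {T : Type} {F : set_system T} {FF : Filter F}
    {a : T -> R} {l : R} : a @ F --> l -> (fun z => `|a z - l|) @ F --> 0.
Proof.
by move=> al; rewrite -(normr0 R) -(subrr l); apply: cvg_norm; apply: cvgB => //;
  exact: cvg_cst.
Qed.

Lemma is_derive_continuous {R : realType} (f : R -> R) (x a : R) :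
  is_derive x 1 f a -> f @ x --> f x.
Proof.
by move=> [/derivable1_diffP/differentiable_continuous].
Qed.

(** * Differentiability from the increment bounds *)

Section renewal_derivative.
Context {R : realType} {delta F G : R -> R} {u f g : R}.
Hypotheses (u0 : 0 < u) (delta01 : forall z, 0 < z -> 0 <= delta z <= 1).
Hypothesis delta_nd : forall v w, 0 < v -> v <= w -> delta v <= delta w.
Hypothesis F01 : forall z, 0 <= F z <= 1.
Hypotheses (F_nd : nondecreasing_fun F) (G_nd : nondecreasing_fun G).
Hypothesis increment : forall v w, 0 < v -> v <= w ->
  delta v * F v * (G w - G v) <=
    delta v * (1 - G v * F v) - delta w * (1 - G w * F w) <=
    delta w * F w * (G w - G v).

(* Slope of [delta * (1 - G * F)] with respect to [G], up to sign: it lies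
   between the values of [delta * F] at [u] and at [z]. *)
Let mean z := if G z == G u then delta u * F u else
  (delta u * (1 - G u * F u) - delta z * (1 - G z * F z)) / (G z - G u).

(** If [G z = G u], both increment bounds vanish and so does the left-hand side. *)
Let meanE z : 0 < z ->
  delta u * (1 - G u * F u) - delta z * (1 - G z * F z) = mean z * (G z - G u).
Proof.
move=> z0; rewrite /mean; case: eqVneq => [GE|GN]; last by rewrite divfK// subr_eq0.
rewrite GE subrr mulr0; have [zu|/ltW uz] := leP z u.
  by have := increment _ _ z0 zu; rewrite GE subrr !mulr0; lra.
by have := increment _ _ u0 uz; rewrite GE subrr !mulr0; lra.
Qed.

Let mean_bound z : 0 < z ->
  `|mean z - delta u * F u| <= `|delta z * F z - delta u * F u|.
Proof.
move=> z0; rewrite /mean; case: eqVneq => [GE|GN]; first by rewrite subrr normr0.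
have nd x y : 0 < x -> x <= y -> delta x * F x <= delta y * F y.
  move=> x0 xy; have [[/andP[? _] /andP[? _]]] := (delta01 _ x0, F01 x).
  by apply: ler_pM => //; [exact: delta_nd|exact: F_nd].
have [zu|/ltW uz] := leP z u.
  have Guz : 0 < G u - G z by rewrite subr_gt0 lt_neqAle GN G_nd.
  have /andP[lo up] := increment _ _ z0 zu.
  (* To the left of [u] both differences are nonpositive, and the bounds apply once numerator and
     denominator of the quotient change sign. *)
  rewrite ler0_norm; last first.
    rewrite subr_le0 -opprB -[X in _ / X]opprB invrN mulrNN ler_pdivrMr//; lra.
  rewrite ler0_norm ?subr_le0 ?nd// lerN2 lerB//.
  by rewrite -opprB -[X in _ / X]opprB invrN mulrNN ler_pdivlMr//.
have Guz : 0 < G z - G u by rewrite subr_gt0 lt_neqAle eq_sym GN G_nd.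
have /andP[lo up] := increment _ _ u0 uz.
rewrite ger0_norm; last by rewrite subr_ge0 ler_pdivlMr.
by rewrite ger0_norm ?subr_ge0 ?nd// lerB// ler_pdivrMr.
Qed.

(** Continuity of [delta] comes first, from boundedness of [mean]; it makes [mean] converge to
    [delta u * F u], and then the slopes of [delta] converge. *)
Lemma renewal_is_derive : is_derive u 1 F f -> is_derive u 1 G g ->
  F u * G u < 1 ->
  is_derive u 1 delta (delta u * G u * f / (1 - F u * G u)).
Proof.
move=> dF dG FG1.
have cF := is_derive_continuous _ _ _ dF; have cG := is_derive_continuous _ _ _ dG.
have /is_derive1_caratheodory[f' [fE cf f'u]] := dF.
have /is_derive1_caratheodory[g' [gE cg g'u]] := dG.
have q0 : 0 < 1 - F u * G u by rewrite subr_gt0.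
have pos : \forall z \near u, 0 < z by exact: lt_nbhsr.
have incr z : 0 < z -> (delta z - delta u) * (1 - F u * G u) =
    delta z * (F z * G z - F u * G u) - mean z * (G z - G u).
  by move=> /meanE <-; ring.
have m01 z : 0 < z -> 0 <= delta z * F z <= 1.
  move=> z0; have [[/andP[? ?] /andP[? ?]]] := (delta01 _ z0, F01 z).
  by rewrite mulr_ge0//= mulr_ile1.
(* The bound 2 is 1 for [delta u * F u] plus 1 for the distance of [mean z] from it. *)
have mean2 z : 0 < z -> `|mean z| <= 2.
  move=> z0; rewrite -[mean z](subrK (delta u * F u)) (le_trans (ler_normD _ _))//.
  have /andP[mu0 mu1] := m01 _ u0; have /andP[mz0 mz1] := m01 _ z0.
  rewrite (_ : 2 = 1 + 1 :> R)// lerD//; last by rewrite ger0_norm.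
  by apply: le_trans (mean_bound _ z0) _; rewrite ler_norml; lra.
have cGu : (fun z => `|G z - G u|) @ u --> (0 : R).
  exact: cvg_normB0.
have cdelta : delta @ u --> delta u.
  apply: (cvg_near_normB (fun z =>
    (`|F z * G z - F u * G u| + 2 * `|G z - G u|) / (1 - F u * G u))).
    near=> z; have z0 : 0 < z by near: z.
    rewrite ler_pdivlMr// -{1}(ger0_norm (ltW q0)) -normrM incr//.
    rewrite (le_trans (ler_normB _ _))// !normrM lerD//.
      have /andP[d0 d1] := delta01 _ z0.
      by rewrite ler_piMl// ger0_norm.
    by rewrite ler_wpM2r// mean2.
  rewrite -[X in _ --> X](mul0r (1 - F u * G u)^-1).
  apply: cvgM; last exact: cvg_cst.
  rewrite -[X in _ --> X]addr0; apply: cvgD.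
    exact: (cvg_normB0 (cvgM cF cG)).
  by rewrite -[X in _ --> X](mulr0 2); apply: cvgM => //; exact: cvg_cst.
have cmean : mean @ u --> delta u * F u.
  apply: (cvg_near_normB (fun z => `|delta z * F z - delta u * F u|)).
    by near=> z; apply: mean_bound; near: z.
  exact: (cvg_normB0 (cvgM cdelta cF)).
apply: (is_derive_near_slope _ (fun z =>
  (delta z * (g' z * F z + G u * f' z) - mean z * g' z) / (1 - F u * G u))).
  near=> z; have z0 : 0 < z by near: z.
  apply: (mulIf (lt0r_neq0 q0)); rewrite incr// mulrAC divfK ?lt0r_neq0//.
  rewrite (_ : F z * G z - F u * G u =
    F z * (G z - G u) + G u * (F z - F u)); last by ring.
  by rewrite gE fE; ring.
(* In the limit the two terms containing [g] cancel. *)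
rewrite (_ : delta u * G u * f =
  delta u * (g * F u + G u * f) - delta u * F u * g); last by ring.
rewrite -f'u -g'u; apply: cvgM; last exact: cvg_cst.
apply: cvgB; last exact: cvgM.
by apply: cvgM => //; apply: cvgD; apply: cvgM => //; exact: cvg_cst.
Unshelve. all: by end_near. Qed.

End renewal_derivative.

(** * Densities *)

Section density.
Context {R : realType} {F f : R -> R}.
Hypothesis Ff : has_density F f.
Notation mu := (@lebesgue_measure R).

Let mf : measurable_fun setT (EFin \o f).
Proof. by case: Ff => mf _ _; exact/measurable_EFinP. Qed.

Let f0 x : (0 <= (f x)%:E)%E. Proof. by case: Ff => _ + _; rewrite lee_fin. Qed.

(** Points are null, so the open ray of the definition may be closed, as the fundamental theorem of
    calculus requires. *)
Lemma density_integralE x : (\int[mu]_(y in `]-oo, x]%classic) (f y)%:E = (F x)%:E)%E.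
Proof.
case: Ff => _ _ ->; rewrite -integral_itv_bndo_bndc//.
exact: measurable_funTS.
Qed.

Lemma integrable_density x : mu.-integrable `]-oo, x] (EFin \o f).
Proof.
apply/integrableP; split; first exact: measurable_funTS.
under eq_integral do rewrite /= ger0_norm -?lee_fin ?f0//.
by rewrite density_integralE ltry.
Qed.

Lemma locally_integrable_density : locally_integrable setT f.
Proof.
split; [exact/measurable_EFinP|exact: openT|].
move=> K _ cK; have [M [_ KM]] := compact_bounded cK.
(* Every number above [M] bounds the compact set, so [K] lies in the ray up to [M + 1]. *)
apply: (@le_lt_trans _ _ (F (M + 1))%:E); last by rewrite ltry.
rewrite -density_integralE.
under eq_integral do rewrite ger0_norm -?lee_fin ?f0//.
apply: ge0_subset_integral => //.
- exact: compact_measurable.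
- exact: measurable_funTS.
- move=> y Ky; rewrite /= in_itv/= (le_trans (ler_norm y))//.
  by apply: (KM (M + 1)) => //; rewrite ltrDl.
Qed.

Lemma ae_is_derive_density : {ae mu, forall x : R, is_derive x (1 : R) F (f x)}.
Proof.
have FE : F = fun x => (\int[mu]_(t in [set` `]-oo, x]]) f t)%R.
  by apply/funext => x; rewrite /Rintegral density_integralE.
have := FTC1Ny integrable_density locally_integrable_density.
apply: filterS; first exact: (ae_filter_ringOfSetsType mu).
move=> x /= [dF <-].
by rewrite FE derive1E; exact: derivableP.
Qed.

End density.

(** A negative slope near [u] would give larger values on the left, a positive one on the right. *)
Lemma is_derive_at_max {R : realType} (F : R -> R) (u a : R) :
  (forall z, F z <= F u) -> is_derive u 1 F a -> a = 0.
Proof.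
move=> Fmax /is_derive1_caratheodory[h [hE ch hu]].
have [a0|a0|//] := ltgtP a 0.
- have hneg : \forall z \near u, h z < 0 by apply: cvgr_lt ch _ _; rewrite hu.
  have /(@filter_ex _ _ (at_left_proper_filter u))[z [hz zu]] :
      \forall z \near u^'-, h z < 0 /\ z < u.
    near=> z; split; last by near: z; exact: nbhs_left_lt.
    by near: z; exact: cvg_within hneg.
  by have := Fmax z; rewrite -subr_le0 hE leNgt nmulr_rgt0// subr_lt0 zu.
- have hpos : \forall z \near u, 0 < h z by apply: cvgr_gt ch _ _; rewrite hu.
  have /(@filter_ex _ _ (at_right_proper_filter u))[z [hz zu]] :
      \forall z \near u^'+, 0 < h z /\ u < z.
    near=> z; split; last by near: z; exact: nbhs_right_gt.
    by near: z; exact: cvg_within hpos.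
  by have := Fmax z; rewrite -subr_le0 hE leNgt pmulr_rgt0// subr_gt0 zu.
Unshelve. all: by end_near. Qed.

(** A set of reals has at most one least element, and a singleton is null. *)
Lemma negligible_least {R : realType} (S : set R) :
  (@lebesgue_measure R).-negligible
    [set x | S x /\ forall y, y < x -> ~ S y].
Proof.
have [[x [Sx xmin]]|noS] :=
  pselect (exists x, S x /\ forall y, y < x -> ~ S y); last first.
  by exists set0; split => // x Sx; apply: noS; exists x.
exists [set x]; split => //; first exact: lebesgue_measure_set1.
move=> y [Sy ymin] /=; case: (ltgtP y x) => // [yx|xy].
  by have := xmin _ yx.
by have := ymin _ xy.
Qed.

(** By induction on the number of steps: the product term of the recursion is already 1, and the
    integral is nonnegative. *)
Lemma non_ruin_eq1 d (T : measurableType d) (R : realType)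
    (P : probability T R) (U V : nat -> {RV P >-> R}) (u : R) :
  iid U -> iid V -> independent_seq U V -> 0 < u ->
  lcdf (U 0%N) u = 1 -> lcdf (V 0%N) u = 1 -> non_ruin U V u = 1.
Proof.
move=> iidU iidV indepUV u0 F1 G1.
have thr1 n : lcdf (@threshold _ _ _ P U V n 0) u = 1.
  elim: n => [|n IH].
    rewrite /lcdf (_ : [set w | _] = setT) ?probability_setT//.
    by apply/seteqP; split.
  apply/eqP; rewrite eq_le lcdf_le1/= -lee_fin.
  rewrite (lcdf_threshold_rec iidU iidV indepUV)//.
  rewrite (lcdf_threshold_shift iidU iidV indepUV)// IH F1 G1 !mulr1.
  rewrite leeDl// integral_ge0// => y _.
  by rewrite lee_fin mulr_ge0 ?lcdf_ge0.
have := @cvg_lcdf_threshold _ _ _ P U V u u0.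
under eq_fun do rewrite thr1.
by move=> cd; apply: EFin_inj; apply: cvg_unique cd (cvg_cst _).
Qed.

(** * The differential equation for the non-ruin probability *)

Section differential_equation.
Context {d : measure_display} {T : measurableType d} {R : realType}.
Context {P : probability T R} {U V : nat -> {RV P >-> R}}.
Hypotheses (iidU : iid U) (iidV : iid V) (indepUV : independent_seq U V).

Let F := lcdf (U 0%N).
Let G := lcdf (V 0%N).
Let delta := non_ruin U V.

Lemma non_ruin_is_derive (u f g : R) : 0 < u ->
  is_derive u 1 F f -> is_derive u 1 G g -> F u * G u < 1 ->
  is_derive u 1 delta (delta u * G u * f / (1 - F u * G u)).
Proof.
move=> u0; apply: renewal_is_derive => //.
- by move=> z z0; rewrite /delta non_ruin_ge0//= non_ruin_le1.
- by move=> v w; exact: non_ruin_nd.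
- by move=> z; rewrite /F /G lcdf_ge0 lcdf_le1.
- exact: lcdf_nd.
- exact: lcdf_nd.
- by move=> v w; exact: non_ruin_increment.
Qed.

Lemma lcdf_mul_eq1 u : ~~ (F u * G u < 1) -> F u = 1 /\ G u = 1.
Proof.
rewrite -leNgt => FG; split; apply/eqP; rewrite eq_le lcdf_le1/= (le_trans FG)//.
  by apply: ler_piMr; [exact: lcdf_ge0|exact: lcdf_le1].
by apply: ler_piMl; [exact: lcdf_ge0|exact: lcdf_le1].
Qed.

(** If [F u * G u < 1], the explicit derivative solves the equation. Otherwise [F u = G u = 1] and
    [f = 0], and both sides are literally [derive1 delta u]. *)
Lemma non_ruin_derive1 (u f g : R) : 0 < u ->
  is_derive u 1 F f -> is_derive u 1 G g ->
  derive1 delta u = derive1 delta u * F u * G u + delta u * G u * f.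
Proof.
move=> u0 dF dG; have [FG|/lcdf_mul_eq1[F1 G1]] := boolP (F u * G u < 1).
  have [_ ddelta] := non_ruin_is_derive _ _ _ u0 dF dG FG.
  rewrite derive1E ddelta.
  have q0 : 1 - F u * G u != 0 by rewrite subr_eq0 gt_eqF.
  by field.
have -> : f = 0.
  by apply: is_derive_at_max dF => z; rewrite F1 lcdf_le1.
by rewrite F1 G1 !mulr1 mulr0 addr0.
Qed.

(** Beyond [v] the function [delta] is constantly 1, in particular near [u]. *)
Lemma non_ruin_derivable_above u v : 0 < u -> v < u -> F v = 1 -> G v = 1 ->
  derivable delta u 1.
Proof.
move=> u0 vu F1 G1.
suff [] : is_derive u 1 delta 0 by [].
have eq1 z : 0 < z -> v < z -> delta z = 1.
  move=> z0 vz; apply: non_ruin_eq1 => //; apply/eqP; rewrite eq_le lcdf_le1/=.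
    by rewrite -F1; apply: lcdf_nd; exact: ltW.
  by rewrite -G1; apply: lcdf_nd; exact: ltW.
apply: (is_derive_near_slope _ (fun=> 0)); last exact: cvg_cst.
near=> z; rewrite !eq1 ?subrr ?mul0r//; near: z; exact: lt_nbhsr.
Unshelve. all: by end_near. Qed.

Lemma ae_non_ruin_derivable (f g : R -> R) : has_density F f -> has_density G g ->
  {ae lebesgue_measure, forall u : R, 0 < u ->
    derivable delta u 1 /\
    derive1 delta u = derive1 delta u * F u * G u + delta u * G u * f u}.
Proof.
move=> /ae_is_derive_density aF /ae_is_derive_density aG.
(* The exceptional points are those where [F] or [G] fails to have its density as derivative, and
   the least point of [S] if there is one. *)
pose S := [set x : R | F x = 1 /\ G x = 1].
have aS : {ae lebesgue_measure, forall x : R, ~ (S x /\ forall y, y < x -> ~ S y)}.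
  apply: negligibleS (negligible_least S) => x /=.
  by move/contrapT.
have ff := ae_filter_ringOfSetsType (@lebesgue_measure R).
move: aF aG aS; apply: (@filterS3 _ _ ff) => u dF dG nS u0.
split; last exact: non_ruin_derive1.
have [FG|/lcdf_mul_eq1 Su] := boolP (F u * G u < 1).
  by have [] := non_ruin_is_derive _ _ _ u0 dF dG FG.
have [v vu [F1 G1]] : exists2 v, v < u & S v.
  apply: contrapT => H; apply: nS; split => // y yu Sy.
  by apply: H; exists y.
exact: non_ruin_derivable_above vu F1 G1.
Qed.

End differential_equation.

Theorem mainTheorem3 (R : realType) (d : measure_display)
  (T : measurableType d) (P : probability T R)
  (U V : nat -> {RV P >-> R}) (F G delta : R -> R)
  (iidU : iid U) (iidV : iid V) (indepUV : independent_seq U V)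
  (posU : positive_seq U) (posV : positive_seq V)
  (FE : F = lcdf (U 0%N)) (GE : G = lcdf (V 0%N))
  (ntF : ~ trivial_df F) (ntG : ~ trivial_df G)
  (deltaE : delta = non_ruin U V) :
  (forall u : R, 0 < u ->
    (delta u)%:E = ((delta u * G u * F u)%:E +
      \int[distribution P (V 0%N)]_(y in `[u, +oo[%classic)
        (delta y * F y)%:E)%E) /\
  (forall f g : R -> R, has_density F f -> has_density G g ->
    {ae lebesgue_measure, forall u : R, 0 < u ->
      derivable delta u 1 /\
      derive1 delta u = derive1 delta u * F u * G u + delta u * G u * f u} /\
    (forall u : R, 0 < u -> is_derive u 1 F (f u) -> is_derive u 1 G (g u) ->
      (F u * G u < 1 -> derivable delta u 1) /\
      (derivable delta u 1 ->
        derive1 delta u = derive1 delta u * F u * G u + delta u * G u * f u))).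
Proof.
rewrite {}FE {}GE {}deltaE in ntF ntG *; split => [u|f g Ff Gg].
  exact: non_ruin_integral_equation.
split; first exact: ae_non_ruin_derivable Gg.
move=> u u0 dF dG; split => [FG|_].
  by have [] := non_ruin_is_derive iidU iidV indepUV u _ _ u0 dF dG FG.
exact: non_ruin_derive1 dG.
Qed.
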